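(* Let $d\ge 3$, let $V$ be a vector space over $F=\mathbb{F}_2$ with ordered basis $(e_1,\dots,e_d)$, and let $G=GL(V)$. Let $G$ act on the parameter space $\Omega_d$ as follows: for $\omega\in\Omega_d$, $S\in G$, and $T=(t_{ij})$ the matrix of $S^{-1}$, the coordinates of $\omega^S$ are $$\omega_{uvw}^S = \sum_{i<j<k}(t_{ui}t_{vj}t_{wk} + t_{ui}t_{vk}t_{wj} + t_{uj}t_{vi}t_{wk} + t_{uj}t_{vk}t_{wi} + t_{uk}t_{vi}t_{wj} + t_{uk}t_{vj}t_{wi})\omega_{ijk}\quad(1\le u<v<w\le d),$$ $$\omega_{uv}^S = \sum_{i<j}(t_{ui}t_{vj}+t_{uj}t_{vi})\omega_{ij}+ \sum_{i<j<k}(t_{ui}t_{uj}t_{vk} + t_{ui}t_{uk}t_{vj} + t_{uj}t_{uk}t_{vi} + t_{ui}t_{vj}t_{vk} + t_{uj}t_{vi}t_{vk} + t_{uk}t_{vi}t_{vj})\omega_{ijk}\quad(1\le u<v\le d),$$ $$\omega_u^S = \sum_i t_{ui}\omega_i + \sum_{i<j}t_{ui}t_{uj}\omega_{ij} + \sum_{i<j<k} t_{ui}t_{uj}t_{uk}\omega_{ijk}\quad(1\le u\le d).$$ Then this is an action of $G$ on $\Omega_d$, and its orbits are in one-to-one correspondence with the isomorphism classes of code loops of order $2^{d+1}$. Moreover, $\Omega_d/G$ consists of all vectors $w[1]\oplus w[2]\oplus w[3]$ such that $$w[3]\in \Omega_d[3]/G,\quad w[2]\in (\Omega_d[2]\oplus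 w[3])/G_{w[3]},\quad w[1]\in (\Omega_d[1]\oplus w[2]\oplus w[3])/G_{w[2]\oplus w[3]}.$$
   Context: Parameter space: $\Omega_d=\bigoplus_I F e_I$, where $I$ runs over all subsets of $\{1,\dots,d\}$ with $1\le|I|\le 3$. An element is written $\omega=(\omega_I)_I$, with coordinates $\omega_i$, $\omega_{ij}$ ($i<j$), $\omega_{ijk}$ ($i<j<k$) in $F$. For $1\le k\le 3$, $\Omega_d[k]=\sum_{|I|=k}Fe_I$ and $\omega[k]$ is the projection of $\omega$ onto $\Omega_d[k]$, so $\omega=\omega[1]\oplus\omega[2]\oplus\omega[3]$. Linear maps act on $V$ on the right (row vectors), so $e_uS^{-1}=\sum_i t_{ui}e_i$. Orbit representatives: for a group $H$ acting on a set $X$, $X/H$ denotes a set of orbit representatives, containing exactly one element of each orbit. The component $\omega^S[3]$ depends only on $S$ and $\omega[3]$, and $\omega^S[2]$ only on $S$, $\omega[2]$ and $\omega[3]$, so $G$ acts on $\Omega_d[3]$ and on $\Omega_d[2]\oplus\Omega_d[3]$. $G_{w[3]}$ denotes the stabilizer of $w[3]$ in $G$ acting on $\Omega_d[3]$; it acts on the coset $\Omega_d[2]\oplus w[3]=\{c\oplus w[3] : c\in\Omega_d[2]\}$. $G_{w[2]\oplus w[3]}$ denotes the stabilizer of $w[2]\oplus w[3]$ in $G$ acting on $\Omega_d[2]\oplus\Omega_d[3]$; it acts on $\Omega_d[1]\oplus w[2]\oplus w[3]=\{p\oplus w[2]\oplus w[3]: p\in\Omega_d[1]\}$. Elements of these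 cosets are identified with their first (varying) components, so the last display means: for any choice of such representatives at each of the three stages, the resulting vectors $w[1]\oplus w[2]\oplus w[3]$ form a set of representatives of the $G$-orbits on $\Omega_d$, one for each orbit. A loop is a nonempty set $Q$ with a binary operation and an element $1$ such that $x\cdot 1=1\cdot x=x$ for all $x\in Q$ and all left and right translations are bijections of $Q$. Code loops: for $u=(u_1,\dots,u_n),v=(v_1,\dots,v_n)\in \mathbb{F}_2^n$ let $|u|\in\mathbb{Z}$ be the Hamming weight of $u$ and let $u\cap v=(u_1v_1,\dots,u_nv_n)$. A doubly even binary code is a linear subspace $U$ of some $\mathbb{F}_2^n$ with $|u|\equiv 0\pmod 4$ for every $u\in U$ (then $|u|/4$, $|u\cap v|/2$, $|u\cap v\cap w|$ are integers). A factor set on $U$ is a map $\theta:U^2\to \mathbb{F}_2$ such that for all $u,v,w\in U$: $\theta(u,u)\equiv |u|/4 \pmod 2$; $\theta(u,v)+\theta(v,u)\equiv |u\cap v|/2\pmod 2$; $\theta(u,v)+\theta(u+v,w)+\theta(v,w)+\theta(u,v+w)\equiv |u\cap v\cap w|\pmod 2$. A code loop is a loop (isomorphic to one) defined on $\mathbb{F}_2\times U$ by $(a,u)(b,v)=(a+b+\theta(u,v),u+v)$, where $U$ is a doubly even binary code and $\theta$ is a factor set on $U$. *)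

(* Defs.v *)
From HB Require Import structures.
From mathcomp Require Import classical_sets functions cardinality.
From mathcomp Require Import all_boot all_order all_algebra all_fingroup.
Set Implicit Arguments.
Unset Strict Implicit.
Unset Printing Implicit Defensive.
Import GroupScope GRing.Theory.
Local Open Scope ring_scope.

(* GL(V), as a finite group.  Maps act on V on the right, so the product    *)
(* S * T is "S first, then T", i.e. the endomorphism T \o S.                *)
Section GeneralLinearGroup.
Variable V : vectType 'F_2.

Record GL := MkGL { GLfun :> 'End(V); GL_ker0 : lker GLfun == 0%VS }.
HB.instance Definition _ := [isSub for GLfun].
HB.instance Definition _ := [Choice of GL by <:].

Definition GLmx (S : GL) := VectorInternalTheory.f2mx S.
Definition mxGL A : option GL := insub (Hom A).
Lemma GLmxK : pcancel GLmx mxGL.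
Proof. by case=> -[A] S0; rewrite /mxGL /GLmx insubT. Qed.
HB.instance Definition _ := PCanIsCountable GLmxK.
HB.instance Definition _ : isFinite GL := PCanIsFinite GLmxK.

Fact GL_one_ker0 : lker (\1 : 'End(V))%VF == 0%VS.
Proof. by apply/lker0P => x y; rewrite !id_lfunE. Qed.
Definition GL_one := MkGL GL_one_ker0.

Fact GL_mul_ker0 (S T : GL) : lker (T \o S)%VF == 0%VS.
Proof.
apply/lker0P => x y; rewrite !comp_lfunE.
by move/(elimT lker0P (GL_ker0 T))/(elimT lker0P (GL_ker0 S)).
Qed.
Definition GL_mul (S T : GL) := MkGL (GL_mul_ker0 S T).

Fact GL_inv_ker0 (S : GL) : lker (S^-1)%VF == 0%VS.
Proof.
apply/lker0P => x y eq_xy.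
by rewrite -(lker0_lfunVK (GL_ker0 S) x) eq_xy lker0_lfunVK ?GL_ker0.
Qed.
Definition GL_inv (S : GL) := MkGL (GL_inv_ker0 S).

Fact GL_mulA : associative GL_mul.
Proof. by move=> S T U; apply: val_inj; rewrite /= comp_lfunA. Qed.
Fact GL_mul1 : left_id GL_one GL_mul.
Proof. by move=> S; apply: val_inj; rewrite /= comp_lfun1r. Qed.
Fact GL_mulV : left_inverse GL_one GL_inv GL_mul.
Proof.
move=> S; apply: val_inj; apply/lfunP=> x /=.
by rewrite comp_lfunE id_lfunE lker0_lfunVK ?GL_ker0.
Qed.
HB.instance Definition _ := Finite_isGroup.Build GL GL_mulA GL_mul1 GL_mulV.

(* The matrix T = (t_ui) of S^-1: e_u S^-1 = \sum_i t_ui e_i.               *)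
Definition inv_coords d (e : d.-tuple V) (S : GL) : 'M['F_2]_d :=
  \matrix_(u, i) coord e i ((S^-1)%g (tnth e u)).

End GeneralLinearGroup.

(* A k-subset of the d indices is encoded by its increasing enumeration, as *)
(* in the coordinates w_i, w_ij (i < j), w_ijk (i < j < k); the direct sum  *)
(* of the three layers is their cartesian product.                          *)
Definition pairs d := {p : 'I_d * 'I_d | (p.1 < p.2)%N}.
Definition triples d := {p : 'I_d * 'I_d * 'I_d | (p.1.1 < p.1.2 < p.2)%N}.

Definition Omega1 d := {ffun 'I_d -> 'F_2}.
Definition Omega2 d := {ffun pairs d -> 'F_2}.
Definition Omega3 d := {ffun triples d -> 'F_2}.
Definition Omega23 d := (Omega2 d * Omega3 d)%type.
Definition Omega d := (Omega1 d * Omega23 d)%type.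

Section Action.
Variables (d : nat) (T : 'M['F_2]_d).

Definition move3 (w3 : Omega3 d) : Omega3 d :=
  [ffun r : triples d => let: (u, v, w) := \val r in
    \sum_(q : triples d) (let: (i, j, k) := \val q in
      (T u i * T v j * T w k + T u i * T v k * T w j +
       T u j * T v i * T w k + T u j * T v k * T w i +
       T u k * T v i * T w j + T u k * T v j * T w i) * w3 q)].

Definition move2 (w2 : Omega2 d) (w3 : Omega3 d) : Omega2 d :=
  [ffun r : pairs d => let: (u, v) := \val r in
    \sum_(p : pairs d) (let: (i, j) := \val p in
      (T u i * T v j + T u j * T v i) * w2 p) +
    \sum_(q : triples d) (let: (i, j, k) := \val q in
      (T u i * T u j * T v k + T u i * T u k * T v j +
       T u j * T u k * T v i + T u i * T v j * T v k +
       T u j * T v i * T v k + T u k * T v i * T v j) * w3 q)].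

Definition move1 (w1 : Omega1 d) (w2 : Omega2 d) (w3 : Omega3 d) : Omega1 d :=
  [ffun u : 'I_d =>
    \sum_i T u i * w1 i +
    \sum_(p : pairs d) (let: (i, j) := \val p in T u i * T u j * w2 p) +
    \sum_(q : triples d) (let: (i, j, k) := \val q in
      T u i * T u j * T u k * w3 q)].

Definition move23 (x : Omega23 d) : Omega23 d := (move2 x.1 x.2, move3 x.2).
Definition move (x : Omega d) : Omega d :=
  (move1 x.1 x.2.1 x.2.2, move23 x.2).

End Action.

Section Orbits.
Variables (gT : finGroupType) (D : {set gT}) (rT : finType).
Variables (to : action D rT) (A : {set gT}).

Definition orbits (Y : {set rT}) : {set {set rT}} := orbit to A @: Y.

(* X meets every A-orbit on Y in exactly one element.                       *)
Definition orbit_reps (Y X : {set rT}) : bool :=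
  is_transversal X (orbits Y) Y.

End Orbits.

Record loop := Loop {
  loop_sort :> Type;
  loop_mul : loop_sort -> loop_sort -> loop_sort;
  loop_one : loop_sort;
  loop_mul1x : left_id loop_one loop_mul;
  loop_mulx1 : right_id loop_one loop_mul;
  loop_left_bij : forall x, bijective (fun y => loop_mul x y);
  loop_right_bij : forall x, bijective (fun y => loop_mul y x)
}.

Definition loop_isom (L M : loop) : Prop :=
  exists2 f : L -> M, bijective f & {morph f : x y / loop_mul x y}.

Definition loop_order (L : loop) (n : nat) : Prop :=
  ([set: L] #= `I_n)%card.

Section Codes.
Variable n : nat.

Definition wt (u : 'rV['F_2]_n) : nat := #|[set i | u 0 i != 0]|.
Definition cap_vec (u v : 'rV['F_2]_n) : 'rV['F_2]_n := \row_i (u 0 i * v 0 i).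

Definition doubly_even (U : {vspace 'rV['F_2]_n}) : Prop :=
  forall u, u \in U -> (4 %| wt u)%N.

(* The quotients below are exact when U is doubly even, and m%:R : 'F_2 is  *)
(* the residue of m modulo 2.                                               *)
Definition factor_set (U : {vspace 'rV['F_2]_n})
    (theta : subvs_of U -> subvs_of U -> 'F_2) : Prop :=
  [/\ forall u, theta u u = (wt (vsval u) %/ 4)%:R,
      forall u v,
        theta u v + theta v u = (wt (cap_vec (vsval u) (vsval v)) %/ 2)%:R
    & forall u v w,
        theta u v + theta (u + v) w + theta v w + theta u (v + w) =
          (wt (cap_vec (cap_vec (vsval u) (vsval v)) (vsval w)))%:R].

Definition code_mul (U : {vspace 'rV['F_2]_n})
    (theta : subvs_of U -> subvs_of U -> 'F_2) (x y : 'F_2 * subvs_of U) :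
    'F_2 * subvs_of U :=
  (x.1 + y.1 + theta x.2 y.2, x.2 + y.2).

End Codes.

Definition code_loop (L : loop) : Prop :=
  exists (n : nat) (U : {vspace 'rV['F_2]_n})
      (theta : subvs_of U -> subvs_of U -> 'F_2),
    [/\ doubly_even U, factor_set theta
      & exists2 f : 'F_2 * subvs_of U -> L, bijective f &
          forall x y, f (code_mul theta x y) = loop_mul (f x) (f y)].

Definition code_loop_classes (m : nat) : set (set loop) :=
  [set [set M | loop_isom L M]%classic
     | L in [set L | code_loop L /\ loop_order L m]]%classic.

(* Main.v *)
Require Import Defs.
From HB Require Import structures.
From mathcomp Require Import classical_sets functions cardinality.
From mathcomp Require Import all_boot all_order all_algebra all_fingroup.
From mathcomp Require Import ring zify.
Set Implicit Arguments.
Unset Strict Implicit.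
Unset Printing Implicit Defensive.
Import GroupScope GRing.Theory.
Local Open Scope ring_scope.

(** A parameter vector w is the list of coefficients of a polynomial function of
    degree at most 3 without constant term,
      P_w(x) = sum w_i x_i + sum w_ij x_i x_j + sum w_ijk x_i x_j x_k,
    on row vectors x over F_2.  The functions of this kind are exactly the cubic
    ones, those with P(0) = 0 whose third polarization is additive in each argument
    ([peval_coef]), and w_i, w_ij, w_ijk are the values of P_w and of its second and
    third polarizations at basis vectors.  The formulas for w^S are these same values
    taken at the rows of T, so that w^S represents x |-> P_w(xT) ([peval_move]).
    The action is therefore substitution of linear maps, and the action laws follow.

    For a doubly even code U, weight over 4 is a cubic function on U modulo 2, its
    polarizations are the right-hand sides in the definition of a factor set, and
    so factor sets and code loops can be described from the cubic function alone.
    Four facts give the correspondence between orbits and isomorphism classes.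
    - Each P_w has an explicit factor set, hence a loop L_w ([factor_theta]).
    - Two factor sets of the same cubic function differ by a symmetric cocycle
      vanishing on the diagonal.  Such a cocycle describes an extension of exponent 2,
      which splits, so it is a coboundary ([symmetric_cocycle_coboundary]).  Thus the
      loop depends on the cubic function only, up to linear substitutions
      ([twisted_iso_of_additive]).
    - Conversely, consider an isomorphism between loops on F_2 x X.  If all squares are
      trivial, then both cubic functions vanish.  Otherwise the squares generate the
      central copy of F_2, which is therefore preserved, and the isomorphism induces
      on X a linear map carrying one cubic function, the squaring map, to the other
      ([additive_of_twisted_iso]).
    - Every P_w comes from a doubly even code ([code_of_form]), since the integer
      4abc, for bits a, b, c, is a combination of a, b, c and their sums modulo 2
      ([realizable_dot3]).

    The statement on representatives is a fact on an equivariant map p : X -> Y of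
    G-sets ([orbit_reps_two_stage]), used for the two maps that forget a layer:
    representatives for Y together with representatives, on the fibre of each of
    them, for its stabilizer, form representatives for X. *)

(** * Cubic functions over the field with two elements *)

Section Polarization.
Variable X : zmodType.
Implicit Types (P : X -> 'F_2) (x y z t : X).

Definition polar2 P x y := P (x + y) - P x - P y.
Definition polar3 P x y z := polar2 P (x + y) z - polar2 P x z - polar2 P y z.

(** The third polarization is symmetric, so additivity in one argument is additivity
    in all three. *)
Definition cubic P :=
  P 0 = 0 /\ forall x t y z, polar3 P (x + t) y z = polar3 P x y z + polar3 P t y z.

Lemma F2_cases (a : 'F_2) : a = 0 \/ a = 1.
Proof.
by case: a => -[|[|//]] i; [left|right]; apply: val_inj.
Qed.

Lemma F2_addrr (a : 'F_2) : a + a = 0.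
Proof. by case: (F2_cases a) => ->; apply: val_inj. Qed.

Lemma F2_opp (a : 'F_2) : - a = a.
Proof. by apply/esym/eqP; rewrite -addr_eq0 F2_addrr. Qed.

Lemma polar2C P x y : polar2 P x y = polar2 P y x.
Proof. by rewrite /polar2 (addrC x); ring. Qed.

Lemma polar3C12 P x y z : polar3 P x y z = polar3 P y x z.
Proof. by rewrite /polar3 (addrC x); ring. Qed.

Lemma polar3C23 P x y z : polar3 P x y z = polar3 P x z y.
Proof. by rewrite /polar3 /polar2 (addrAC x z y) (addrC z y); ring. Qed.

Lemma cubicB P Q : cubic P -> cubic Q -> cubic (fun x => P x - Q x).
Proof.
move=> [P0 P3] [Q0 Q3]; split=> [|x t y z]; first by rewrite P0 Q0 subr0.
have pB a b c :
    polar3 (fun x => P x - Q x) a b c = polar3 P a b c - polar3 Q a b c.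
  by rewrite /polar3 /polar2; ring.
by rewrite !pB P3 Q3; ring.
Qed.

End Polarization.

Lemma cubic_comp (X Y : zmodType) (P : Y -> 'F_2) (g : X -> Y) :
  {morph g : x y / x + y} -> cubic P -> cubic (P \o g).
Proof.
move=> gD [P0 P3].
have g0 : g 0 = 0 by apply: (addrI (g 0)); rewrite -gD !addr0.
split=> [|x t y z]; first by rewrite /= g0.
by move: (P3 (g x) (g t) (g y) (g z)); rewrite /polar3 /polar2 /= !gD.
Qed.

Section Forms.
Variable d : nat.
Implicit Types (x y z : 'rV['F_2]_d) (w : Omega d).

Lemma additive_basis0 (f : 'rV['F_2]_d -> 'F_2) :
  {morph f : x y / x + y} -> (forall i, f (delta_mx 0 i) = 0) -> forall x, f x = 0.
Proof.
move=> fD fe x.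
have f0 : f 0 = 0 by apply: (addrI (f 0)); rewrite -fD !addr0.
rewrite (row_sum_delta x); elim/big_rec: _ => // i y _ fy.
rewrite fD fy addr0; case: (F2_cases (x 0 i)) => ->.
  by rewrite scale0r.
by rewrite scale1r.
Qed.

(** Over F_2 the polarizations are alternating, so vanishing on increasing tuples of
    basis vectors is vanishing on all tuples.  Then the third polarization vanishes by
    additivity, which makes the second one additive, hence zero, which in turn makes
    P additive, hence zero. *)
Lemma cubic_coef0 (P : 'rV['F_2]_d -> 'F_2) : cubic P ->
  (forall i, P (delta_mx 0 i) = 0) ->
  (forall i j : 'I_d, (i < j)%N -> polar2 P (delta_mx 0 i) (delta_mx 0 j) = 0) ->
  (forall i j k : 'I_d, (i < j < k)%N ->
     polar3 P (delta_mx 0 i) (delta_mx 0 j) (delta_mx 0 k) = 0) ->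
  forall x, P x = 0.
Proof.
move=> [P0 P3] c1 c2 c3.
have xx x : x + x = 0 by apply/rowP=> i; rewrite !mxE F2_addrr.
have alt2 x : polar2 P x x = 0 by rewrite /polar2 xx P0 sub0r -opprD F2_addrr oppr0.
have alt3 x z : polar3 P x x z = 0.
  by rewrite /polar3 xx /polar2 add0r P0 subr0 subrr sub0r -opprD F2_addrr oppr0.
have c3' (i j k : 'I_d) : polar3 P (delta_mx 0 i) (delta_mx 0 j) (delta_mx 0 k) = 0.
  wlog lij : i j k / (i < j)%N => [W|].
    case: (ltngtP i j) => [/W //|/W -W1|/val_inj ->]; last exact: alt3.
    by rewrite polar3C12.
  case: (ltngtP j k) => [jk|kj|/val_inj <-].
  - by apply: c3; rewrite lij.
  - case: (ltngtP i k) => [ik|ki|/val_inj <-].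
    + by rewrite polar3C23; apply: c3; rewrite ik.
    + by rewrite polar3C23 polar3C12; apply: c3; rewrite ki.
    + by rewrite polar3C23 alt3.
  - by rewrite polar3C12 polar3C23 alt3.
have p3 x y z : polar3 P x y z = 0.
  move: x; apply: additive_basis0 => [x t|i]; first exact: P3.
  move: y; apply: additive_basis0 => [x t|j].
    by rewrite polar3C12 P3 !(polar3C12 P (delta_mx 0 i)).
  move: z; apply: additive_basis0 => [x t|k]; last exact: c3'.
  rewrite polar3C23 polar3C12 P3 !(polar3C12 _ _ (delta_mx 0 i)).
  by rewrite !(polar3C23 _ _ (delta_mx 0 j)).
have p2D x y z : polar2 P (x + y) z = polar2 P x z + polar2 P y z.
  by apply/eqP; rewrite -subr_eq0 opprD addrA; apply/eqP; exact: p3.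
have p2 x y : polar2 P x y = 0.
  move: x; apply: additive_basis0 => [x t|i]; first exact: p2D.
  move: y; apply: additive_basis0 => [x t|j].
    by rewrite polar2C p2D !(polar2C _ (delta_mx 0 i)).
  case: (ltngtP i j) => [/c2 //|/c2|/val_inj ->]; last exact: alt2.
  by rewrite polar2C.
apply: additive_basis0 => // x y; apply/eqP; rewrite -subr_eq0 opprD addrA.
by apply/eqP; exact: p2.
Qed.

Definition peval w x : 'F_2 :=
  \sum_i x 0 i * w.1 i +
  \sum_(p : pairs d) (let: (i, j) := \val p in x 0 i * x 0 j * w.2.1 p) +
  \sum_(q : triples d) (let: (i, j, k) := \val q in
    x 0 i * x 0 j * x 0 k * w.2.2 q).

Definition quad_polar w x y : 'F_2 :=
  \sum_(p : pairs d) (let: (i, j) := \val p in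
      (x 0 i * y 0 j + x 0 j * y 0 i) * w.2.1 p) +
    \sum_(q : triples d) (let: (i, j, k) := \val q in
      (x 0 i * x 0 j * y 0 k + x 0 i * x 0 k * y 0 j +
       x 0 j * x 0 k * y 0 i + x 0 i * y 0 j * y 0 k +
       x 0 j * y 0 i * y 0 k + x 0 k * y 0 i * y 0 j) * w.2.2 q).

Definition cubic_polar w x y z : 'F_2 :=
  \sum_(q : triples d) (let: (i, j, k) := \val q in
      (x 0 i * y 0 j * z 0 k + x 0 i * y 0 k * z 0 j +
       x 0 j * y 0 i * z 0 k + x 0 j * y 0 k * z 0 i +
       x 0 k * y 0 i * z 0 j + x 0 k * y 0 j * z 0 i) * w.2.2 q).

Lemma polar2_peval w x y : polar2 (peval w) x y = quad_polar w x y.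
Proof.
rewrite /polar2 /peval /quad_polar.
have regroup (a b c a1 b1 c1 a2 b2 c2 : 'F_2) :
    a + b + c - (a1 + b1 + c1) - (a2 + b2 + c2) =
    (a - a1 - a2) + (b - b1 - b2) + (c - c1 - c2) by ring.
rewrite regroup -!sumrB; congr (_ + _).
  rewrite big1 ?add0r => [|i _]; last by rewrite mxE; ring.
  by apply: eq_bigr => -[[i j] /= h] _; rewrite !mxE; ring.
by apply: eq_bigr => -[[[i j] k] /= h] _; rewrite !mxE; ring.
Qed.

Lemma polar3_peval w x y z : polar3 (peval w) x y z = cubic_polar w x y z.
Proof.
rewrite /polar3 !polar2_peval /quad_polar /cubic_polar.
have regroup (b c b1 c1 b2 c2 : 'F_2) :
    b + c - (b1 + c1) - (b2 + c2) = (b - b1 - b2) + (c - c1 - c2) by ring.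
rewrite regroup -!sumrB big1 ?add0r => [|[[i j] /= h] _]; last by rewrite !mxE; ring.
by apply: eq_bigr => -[[[i j] k] /= h] _; rewrite !mxE; ring.
Qed.

Lemma cubic_peval w : cubic (peval w).
Proof.
split=> [|x t y z].
  rewrite /peval big1 => [|i _]; last by rewrite mxE mul0r.
  rewrite big1 => [|[[i j] /= h] _]; last by rewrite !mxE !mul0r.
  by rewrite big1 ?addr0 // => -[[[i j] k] /= h] _; rewrite !mxE !mul0r.
rewrite !polar3_peval -big_split /=.
by apply: eq_bigr => -[[[i j] k] /= h] _; rewrite !mxE; ring.
Qed.

(** The coordinates of P along the rows of T; for T the identity matrix they are the
    coefficients of P. *)
Definition coef (P : 'rV['F_2]_d -> 'F_2) (T : 'M['F_2]_d) : Omega d :=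
  ([ffun u => P (row u T)],
   ([ffun r : pairs d => let: (u, v) := \val r in polar2 P (row u T) (row v T)],
    [ffun r : triples d => let: (u, v, w) := \val r in
       polar3 P (row u T) (row v T) (row w T)])).

(** The formulas that define the action are the polarizations of P_w, evaluated at
    the rows of T. *)
Lemma coef_peval w T : coef (peval w) T = move T w.
Proof.
case: w => w1 [w2 w3]; rewrite /move /coef /move23 /=; congr (_, (_, _)); apply/ffunP.
- move=> u; rewrite !ffunE /peval /=; congr (_ + _ + _).
  + by apply: eq_bigr => i _; rewrite mxE.
  + by apply: eq_bigr => -[[i j] /= h] _; rewrite !mxE.
  + by apply: eq_bigr => -[[[i j] k] /= h] _; rewrite !mxE.
- move=> [[u v] uv]; rewrite !ffunE /= polar2_peval /quad_polar /=; congr (_ + _).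
  + by apply: eq_bigr => -[[i j] /= h] _; rewrite !mxE.
  + by apply: eq_bigr => -[[[i j] k] /= h] _; rewrite !mxE.
- move=> [[[u v] t] uvt]; rewrite !ffunE /= polar3_peval.
  by apply: eq_bigr => -[[[i j] k] /= h] _; rewrite !mxE.
Qed.

(** One index is never equal to two of an increasing tuple, and an increasing tuple is
    never a nontrivial rearrangement of another, so only the leading product of each
    coefficient survives. *)
Lemma move_one w : move 1%:M w = w.
Proof.
have T1 u : (1%:M : 'M['F_2]_d) u u = 1 by rewrite mxE eqxx.
have T2 (u v i j : 'I_d) : (nat_of_ord u = i -> nat_of_ord v = j -> False) ->
    (1%:M : 'M['F_2]_d) u i * (1%:M : 'M['F_2]_d) v j = 0.
  rewrite !mxE -!val_eqE; case: eqP => [e|_ _]; last by rewrite mul0r.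
  by case: eqP => [f /(_ e f)//|_ _]; rewrite mulr0.
have T3 (u v t i j k : 'I_d) :
    (nat_of_ord u = i -> nat_of_ord v = j -> nat_of_ord t = k -> False) ->
    (1%:M : 'M['F_2]_d) u i * (1%:M : 'M['F_2]_d) v j *
    (1%:M : 'M['F_2]_d) t k = 0.
  rewrite (mxE _ _ t) -val_eqE; case: eqP => [e H|_ _]; last by rewrite mulr0.
  by rewrite T2 ?mul0r // => *; apply: H.
case: w => w1 [w2 w3]; rewrite /move /move23 /=; congr (_, (_, _)); apply/ffunP.
- move=> u; rewrite !ffunE /= (bigD1 u) //= T1 mul1r.
  rewrite big1 ?addr0 => [|i /negPf ui]; last by rewrite mxE eq_sym ui mul0r.
  rewrite big1 ?addr0 => [|[[i j] /= h] _]; last by rewrite T2 ?mul0r //; lia.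
  by rewrite big1 ?addr0 // => -[[[i j] k] /= h] _; rewrite T3 ?mul0r //; lia.
- move=> [[u v] uv]; have lt_uv : (u < v)%N := uv.
  rewrite !ffunE /= (bigD1 (exist _ (u, v) uv : pairs d)) //=.
  rewrite [X in _ + X + _ = _]big1 => [|[[i j] /= h] nr]; last first.
    rewrite !T2 ?addr0 ?mul0r //; try lia.
    by move=> ui vj; case/eqP: nr; apply: val_inj; congr (_, _); exact: val_inj.
  rewrite [X in _ + X = _]big1 => [|[[[i j] k] /= h] _]; last first.
    by rewrite !T3 ?addr0 ?mul0r //; lia.
  by rewrite !T1 T2 ?addr0 ?mulr1 ?mul1r //; lia.
- move=> [[[u v] t] uvt]; have lt_uvt : (u < v < t)%N := uvt.
  rewrite !ffunE /= (bigD1 (exist _ (u, v, t) uvt : triples d)) //=.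
  rewrite big1 => [|[[[i j] k] /= h] nr].
    rewrite (T3 u v t u t v) ?(T3 u v t v) ?(T3 u v t t) ?T1; try lia.
    by rewrite !addr0 !mulr1 mul1r.
  rewrite !T3 ?addr0 ?mul0r //; try lia.
  by move=> ui vj tk; case/eqP: nr; apply: val_inj; congr (_, _, _); exact: val_inj.
Qed.

(** The difference of the two sides is cubic, with all its coefficients zero. *)
Lemma peval_coef P : cubic P -> forall x, peval (coef P 1%:M) x = P x.
Proof.
move=> cP x; apply/eqP; rewrite eq_sym -subr_eq0; apply/eqP; move: x.
pose w := coef P 1%:M.
have cw : coef (peval w) 1%:M = w by rewrite coef_peval move_one.
have r (i : 'I_d) : row i (1%:M : 'M['F_2]_d) = delta_mx 0 i by rewrite row1.
apply: cubic_coef0; first exact: cubicB (cubic_peval _).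
- move=> i; have /ffunP/(_ i) := congr1 fst cw.
  by rewrite !ffunE r => ->; rewrite subrr.
- move=> i j ij; pose p : pairs d := exist _ (i, j) ij.
  have /ffunP/(_ p) := congr1 (fun w => w.2.1) cw.
  rewrite !ffunE /= !r => E.
  rewrite -[RHS](subrr (polar2 P (delta_mx 0 i) (delta_mx 0 j))) -{2}E.
  by rewrite /polar2; ring.
- move=> i j k ijk; pose p : triples d := exist _ (i, j, k) ijk.
  have /ffunP/(_ p) := congr1 (fun w => w.2.2) cw.
  rewrite !ffunE /= !r => E.
  rewrite -[RHS](subrr (polar3 P (delta_mx 0 i) (delta_mx 0 j) (delta_mx 0 k))) -{2}E.
  by rewrite /polar3 /polar2; ring.
Qed.

Lemma peval_inj w w' : peval w =1 peval w' -> w = w'.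
Proof.
move=> E; rewrite -(move_one w) -(move_one w') -!coef_peval /coef.
congr (_, (_, _)); apply/ffunP.
- by move=> u; rewrite !ffunE.
- by move=> [[u v] ?]; rewrite !ffunE /= /polar2 !E.
- by move=> [[[u v] t] ?]; rewrite !ffunE /= /polar3 /polar2 !E.
Qed.

(** The function on the right is cubic, and its coefficients are the coordinates of
    P_w along the rows of T. *)
Lemma peval_move w T x : peval (move T w) x = peval w (x *m T).
Proof.
have cP : cubic (peval w \o mulmxr T).
  by apply: cubic_comp (cubic_peval w) => u v; exact: mulmxDl.
rewrite -coef_peval.
suff -> : coef (peval w) T = coef (peval w \o mulmxr T) 1%:M by rewrite peval_coef.
have r u : row u (1%:M : 'M['F_2]_d) *m T = row u T by rewrite -row_mul mul1mx.
rewrite /coef; congr (_, (_, _)); apply/ffunP.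
- by move=> u; rewrite !ffunE /= r.
- by move=> [[u v] ?]; rewrite !ffunE /= /polar2 /= !mulmxDl !r.
- by move=> [[[u v] t] ?]; rewrite !ffunE /= /polar3 /polar2 /= !mulmxDl !r.
Qed.

Lemma move_mul w T T' : move (T *m T') w = move T (move T' w).
Proof. by apply: peval_inj => x; rewrite !peval_move mulmxA. Qed.

End Forms.

(** * Factor sets and twisted products *)

Section Twisted.
Variable X : zmodType.
Implicit Types (P : X -> 'F_2) (theta : X -> X -> 'F_2).

(** For P the weight over 4 on a doubly even code, these are the conditions defining a
    factor set; here they make sense on any abelian group. *)
Definition factor_for P theta :=
  [/\ forall u, theta u u = P u,
      forall u v, theta u v + theta v u = polar2 P u v
    & forall u v w,
        theta u v + theta (u + v) w + theta v w + theta u (v + w) = polar3 P u v w].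

Definition twisted_mul theta (x y : 'F_2 * X) : 'F_2 * X :=
  (x.1 + y.1 + theta x.2 y.2, x.2 + y.2).

Lemma polar3_0l P v w : P 0 = 0 -> polar3 P 0 v w = 0.
Proof. by move=> P0; rewrite /polar3 /polar2 !add0r P0; ring. Qed.

Lemma factor0l P theta v : P 0 = 0 -> factor_for P theta -> theta 0 v = 0.
Proof.
move=> P0 [diag _ coc]; have := coc 0 0 v.
by rewrite polar3_0l // !add0r diag P0 add0r F2_addrr add0r.
Qed.

Lemma factor0r P theta v : P 0 = 0 -> factor_for P theta -> theta v 0 = 0.
Proof.
move=> P0 F; have [_ com _] := F; have := com 0 v.
by rewrite (factor0l v P0 F) add0r => ->; rewrite /polar2 add0r P0; ring.
Qed.

Section Loop.
Variables (P : X -> 'F_2) (theta : X -> X -> 'F_2).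
Hypotheses (P0 : P 0 = 0) (F : factor_for P theta).

Fact twisted_mul1x : left_id (0, 0) (twisted_mul theta).
Proof. by case=> a u; rewrite /twisted_mul /= (factor0l _ P0 F) !add0r addr0. Qed.

Fact twisted_mulx1 : right_id (0, 0) (twisted_mul theta).
Proof. by case=> a u; rewrite /twisted_mul /= (factor0r _ P0 F) !addr0. Qed.

Fact twisted_left_bij x : bijective (fun y => twisted_mul theta x y).
Proof.
exists (fun z => (z.1 - x.1 - theta x.2 (z.2 - x.2), z.2 - x.2)) => -[a u];
  rewrite /twisted_mul /=; congr (_, _).
- by rewrite (addrC x.2) addrK; ring.
- by rewrite addrC addKr.
- by ring.
- by rewrite addrC subrK.
Qed.

Fact twisted_right_bij x : bijective (fun y => twisted_mul theta y x).
Proof.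
exists (fun z => (z.1 - x.1 - theta (z.2 - x.2) x.2, z.2 - x.2)) => -[a u];
  rewrite /twisted_mul /=; congr (_, _).
- by rewrite addrK; ring.
- by rewrite addrK.
- by ring.
- by rewrite subrK.
Qed.

End Loop.
End Twisted.

(** The carrier of a loop lies in a universe strictly below that of finite types such
    as row vectors, so a finite loop is carried by an initial segment of nat. *)
Section SmallCarrier.
Variables (T : finType) (mul : T -> T -> T) (one : T).
Hypotheses (mul1x : left_id one mul) (mulx1 : right_id one mul).
Hypotheses (left_bij : forall x, bijective (fun y => mul x y))
  (right_bij : forall x, bijective (fun y => mul y x)).

Definition segment : Type := {k : nat | (k < #|T|)%N}.
Definition encode (x : T) : segment := exist _ (nat_of_ord (enum_rank x)) (ltn_ord _).
Definition decode (k : segment) : T := enum_val (Ordinal (proj2_sig k)).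

Fact encodeK : cancel encode decode.
Proof.
by move=> x; rewrite /decode -[RHS]enum_rankK; congr enum_val; apply: val_inj.
Qed.

Fact decodeK : cancel decode encode.
Proof. by case=> k kT; apply: val_inj; rewrite /= enum_valK. Qed.

Definition segment_mul (x y : segment) := encode (mul (decode x) (decode y)).

Fact segment_mul1x : left_id (encode one) segment_mul.
Proof. by move=> x; rewrite /segment_mul encodeK mul1x decodeK. Qed.

Fact segment_mulx1 : right_id (encode one) segment_mul.
Proof. by move=> x; rewrite /segment_mul encodeK mulx1 decodeK. Qed.

Fact segment_left_bij x : bijective (fun y => segment_mul x y).
Proof.
have [h hK Kh] := left_bij (decode x).
by exists (fun z => encode (h (decode z))) => y;
  rewrite /segment_mul encodeK ?hK ?Kh decodeK.
Qed.

Fact segment_right_bij x : bijective (fun y => segment_mul y x).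
Proof.
have [h hK Kh] := right_bij (decode x).
by exists (fun z => encode (h (decode z))) => y;
  rewrite /segment_mul encodeK ?hK ?Kh decodeK.
Qed.

Definition small_loop : loop :=
  Loop segment_mul1x segment_mulx1 segment_left_bij segment_right_bij.

Lemma encode_mul x y : encode (mul x y) = segment_mul (encode x) (encode y).
Proof. by rewrite /segment_mul !encodeK. Qed.

Lemma encode_bij : bijective encode.
Proof. by exists decode; [exact: encodeK|exact: decodeK]. Qed.

Lemma decode_bij : bijective decode.
Proof. by exists encode; [exact: decodeK|exact: encodeK]. Qed.

End SmallCarrier.

Lemma factor_comp (X Y : zmodType) (g : Y -> X) (P : X -> 'F_2) theta :
  {morph g : x y / x + y} -> factor_for P theta ->
  factor_for (P \o g) (fun x y => theta (g x) (g y)).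
Proof.
move=> gD [diag com coc]; split=> [u|u v|u v w] //=.
- by rewrite com /polar2 /= gD.
- by rewrite !gD coc /polar3 /polar2 /= !gD.
Qed.

Lemma eq_factor_for (X : zmodType) (P Q : X -> 'F_2) theta :
  P =1 Q -> factor_for P theta -> factor_for Q theta.
Proof.
by move=> PQ [dg com coc]; split=> *; rewrite ?dg ?com ?coc /polar3 /polar2 ?PQ.
Qed.

Section Coboundary.
Variables (d : nat) (phi : 'rV['F_2]_d -> 'rV['F_2]_d -> 'F_2).
Hypotheses (phi_diag : forall u, phi u u = 0)
  (phi_sym : forall u v, phi u v = phi v u)
  (phi_coc : forall u v w,
     phi u v + phi (u + v) w + phi v w + phi u (v + w) = 0).

(** The extension of 'rV_d by F_2 with cocycle phi is an abelian group of exponent 2,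
    hence splits.  The splitting is built one coordinate at a time, on the subspaces
    of vectors supported on the first k coordinates. *)
Lemma symmetric_cocycle_coboundary :
  exists l : 'rV['F_2]_d -> 'F_2, forall u v, phi u v = l u + l v + l (u + v).
Proof.
have xx (u : 'rV['F_2]_d) : u + u = 0 by apply/rowP=> i; rewrite !mxE F2_addrr.
have phi0 v : phi 0 v = 0.
  by have := phi_coc 0 0 v; rewrite !add0r phi_diag add0r F2_addrr add0r.
pose tail0 k (u : 'rV['F_2]_d) := forall i : 'I_d, (k <= i)%N -> u 0 i = 0.
suff [l lP] : exists l, forall u v, tail0 d u -> tail0 d v ->
    phi u v = l u + l v + l (u + v).
  exists l => u v; apply: lP => i; have := ltn_ord i; lia.
suff H k : (k <= d)%N -> exists l, forall u v, tail0 k u -> tail0 k v ->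
    phi u v = l u + l v + l (u + v) by exact: H.
elim: k => [_|k IH kd].
  exists (fun=> 0) => u v u0 _; rewrite !addr0.
  suff -> : u = 0 by [].
  by apply/rowP=> i; rewrite u0 // mxE.
have [l lP] := IH (ltnW kd); pose i0 := Ordinal kd.
pose e : 'rV['F_2]_d := delta_mx 0 i0.
(* Adding u 0 i0 *: e clears the coordinate i0 of u, since 1 + 1 = 0. *)
pose cut (u : 'rV['F_2]_d) := u + u 0 i0 *: e.
have cutP u : tail0 k.+1 u -> tail0 k (cut u).
  move=> u0 i ki; rewrite !mxE eqxx /=.
  case: eqP => [->|/eqP ne]; first by rewrite mulr1 F2_addrr.
  by rewrite u0 ?mulr0 ?addr0 // ltn_neqAle ki andbT eq_sym.
have cutD u v : cut (u + v) = cut u + cut v.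
  by rewrite /cut mxE scalerDl addrACA.
have phi_e w : phi (w + e) e = phi w e.
  have := phi_coc w e e; rewrite xx phi_diag addr0 (phi_sym w 0) phi0 addr0.
  by move/eqP; rewrite addr_eq0 F2_opp => /eqP ->.
have phi_l x y : phi (x + e) y = phi x y + phi x e + phi (x + y) e.
  have := phi_coc y x e; rewrite (phi_sym y x) (phi_sym y (x + e)) (addrC y x) => E.
  by apply/eqP; rewrite -subr_eq0 F2_opp -{}E; apply/eqP; ring.
(* In the extension, lift u to the product of the lifts of cut u and u 0 i0 *: e. *)
exists (fun u => l (cut u) + phi (cut u) (u 0 i0 *: e)) => u v u0 v0.
rewrite -[in LHS](addrK (u 0 i0 *: e) u) -[in LHS](addrK (v 0 i0 *: e) v).
have N (w : 'rV['F_2]_d) : - w = w by apply/rowP=> i; rewrite mxE F2_opp.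
rewrite !N -!/(cut _) cutD mxE.
have := lP _ _ (cutP _ u0) (cutP _ v0).
move: (cut u) (cut v) (l _) (l _) (l _) => x y lxy ly lx E.
case: (F2_cases (u 0 i0)) => ->; case: (F2_cases (v 0 i0)) => ->;
  rewrite ?F2_addrr ?(addr0, add0r) ?scale0r ?scale1r ?(addr0, add0r)
    ?(phi_sym _ 0) ?phi0 ?addr0 ?add0r //.
- by rewrite phi_sym phi_l phi_sym E (addrC y); ring.
- by rewrite phi_l E; ring.
- rewrite phi_l (phi_sym x) phi_l (phi_sym y) E addrA phi_e (addrC y x).
  set p := phi (x + y) e.
  have -> : lx + ly + lxy + phi y e + p + phi x e + p =
    lx + ly + lxy + phi y e + phi x e + (p + p) by ring.
  by rewrite F2_addrr; ring.
Qed.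

End Coboundary.

(** * The loop of a cubic function *)

Section LoopOf.
Variable d : nat.
Implicit Types w : Omega d.

(** The monomials x_i, x_i x_j, x_i x_j x_k contribute x_i y_i, x_i y_j and the part
    of (x + y)_i (x + y)_j (x + y)_k that is quadratic in x and linear in y. *)
Definition theta_of w (x y : 'rV['F_2]_d) : 'F_2 :=
  \sum_i x 0 i * y 0 i * w.1 i +
  \sum_(p : pairs d) (let: (i, j) := \val p in x 0 i * y 0 j * w.2.1 p) +
  \sum_(q : triples d) (let: (i, j, k) := \val q in
    (x 0 i * x 0 j * y 0 k + x 0 i * y 0 j * x 0 k + y 0 i * x 0 j * x 0 k) *
    w.2.2 q).

Lemma factor_theta w : factor_for (peval w) (theta_of w).
Proof.
split=> [u|u v|u v t].
- rewrite /theta_of /peval; congr (_ + _ + _).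
    by apply: eq_bigr => i _; case: (F2_cases (u 0 i)) => ->; rewrite ?mul0r ?mul1r.
  apply: eq_bigr => -[[[i j] k] /= h] _.
  by rewrite F2_addrr add0r.
- have regroup (a b c a1 b1 c1 : 'F_2) :
    a + b + c + (a1 + b1 + c1) = (a + a1) + (b + b1) + (c + c1) by ring.
  rewrite polar2_peval /theta_of /quad_polar regroup -!big_split /=.
  rewrite big1 => [|i _]; last by rewrite (mulrC (v 0 i)) F2_addrr.
  rewrite add0r; congr (_ + _); apply: eq_bigr.
    by move=> [[i j] /= h] _; ring.
  by move=> [[[i j] k] /= h] _; ring.
- have regroup (a b c a1 b1 c1 a2 b2 c2 a3 b3 c3 : 'F_2) :
    a + b + c + (a1 + b1 + c1) + (a2 + b2 + c2) + (a3 + b3 + c3) =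
    (a + a1 + (a2 + a3)) + (b + b1 + (b2 + b3)) + (c + c1 + (c2 + c3)) by ring.
  have twice (a b : 'F_2) : a = b -> a + b = 0 by move=> ->; exact: F2_addrr.
  rewrite polar3_peval /theta_of /cubic_polar regroup -!big_split /=.
  rewrite big1 => [|i _].
    rewrite big1 => [|[[i j] /= h] _].
      rewrite !add0r; apply: eq_bigr => -[[[i j] k] /= h] _.
      rewrite !mxE -!mulrDl; congr (_ * _).
      (* As integer polynomials the two sides differ by twice the sum added here. *)
      pose m (x y z : 'rV['F_2]_d) : 'F_2 := x 0 i * y 0 j * z 0 k.
      rewrite -[RHS]addr0 -(F2_addrr (m u u v + m u v u + m v u u + m u u t +
        m u t u + m t u u + m v v t + m v t v + m t v v)) /m.
      by ring.
    by rewrite !mxE -!mulrDl twice ?mul0r //; ring.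
  by rewrite !mxE -!mulrDl twice ?mul0r //; ring.
Qed.

Definition loop_of w : loop :=
  small_loop (twisted_mul1x (proj1 (cubic_peval w)) (factor_theta w))
             (twisted_mulx1 (proj1 (cubic_peval w)) (factor_theta w))
             (twisted_left_bij (theta_of w)) (twisted_right_bij (theta_of w)).

(** After transport along g the two factor sets have the same diagonal, commutator and
    coboundary, so their sum satisfies [symmetric_cocycle_coboundary]; the resulting
    function l corrects (a, u) |-> (a, g u) to an isomorphism. *)
Lemma twisted_iso_of_additive P1 P2 theta1 theta2 (g : 'rV['F_2]_d -> 'rV['F_2]_d) :
  P1 0 = 0 -> factor_for P1 theta1 -> factor_for P2 theta2 ->
  {morph g : x y / x + y} -> bijective g -> P2 \o g =1 P1 ->
  exists2 f : 'F_2 * 'rV['F_2]_d -> 'F_2 * 'rV['F_2]_d, bijective f &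
    forall x y, f (twisted_mul theta1 x y) = twisted_mul theta2 (f x) (f y).
Proof.
move=> P10 [dg1 com1 coc1] F2 gD [h gK hK] P2g.
have [dg2 com2 coc2] := factor_comp gD F2.
have pg2 u v : polar2 (P2 \o g) u v = polar2 P1 u v by rewrite /polar2 !P2g.
pose phi u v := theta1 u v + theta2 (g u) (g v).
have [l lP] : exists l, forall u v, phi u v = l u + l v + l (u + v).
  apply: symmetric_cocycle_coboundary => [u|u v|u v w]; rewrite /phi.
  - by rewrite dg1 dg2 P2g F2_addrr.
  - have -> : theta1 u v = theta1 v u + (theta2 (g u) (g v) + theta2 (g v) (g u)).
      by rewrite com2 pg2 -com1 (addrC (theta1 u v)) addrA F2_addrr add0r.
    by rewrite -addrA; congr (_ + _); rewrite addrAC F2_addrr add0r.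
  - have C1 := coc1 u v w; have C2 := coc2 u v w.
    rewrite (_ : polar3 (P2 \o g) u v w = polar3 P1 u v w) in C2; last first.
      by rewrite /polar3 !pg2.
    by rewrite -(F2_addrr (polar3 P1 u v w)) -{1}C1 -C2; ring.
exists (fun x => (x.1 + l x.2, g x.2)).
  exists (fun x => (x.1 - l (h x.2), h x.2)) => -[a u] /=.
    by rewrite gK addrK.
  by rewrite hK subrK.
move=> [a u] [b v]; rewrite /twisted_mul /= gD; congr (_, _).
have := lP u v; rewrite /phi => E.
have -> : theta1 u v = theta2 (g u) (g v) + (l u + l v + l (u + v)).
  by rewrite -E addrCA F2_addrr addr0.
transitivity (a + b + theta2 (g u) (g v) + l u + l v + (l (u + v) + l (u + v))).
  by ring.
by rewrite F2_addrr; ring.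
Qed.

(** The square of (a, u) is (P u, 0).  If P1 is not zero, then f (1, 0) is a square
    other than the identity, hence f fixes (1, 0) and induces a map g on second
    components, which is compatible with squares.  If P1 is zero, then all squares are
    trivial in both loops and P2 is zero as well, so the identity serves. *)
Lemma additive_of_twisted_iso P1 P2 theta1 theta2
    (f : 'F_2 * 'rV['F_2]_d -> 'F_2 * 'rV['F_2]_d) :
  P1 0 = 0 -> P2 0 = 0 -> factor_for P1 theta1 -> factor_for P2 theta2 ->
  bijective f ->
  (forall x y, f (twisted_mul theta1 x y) = twisted_mul theta2 (f x) (f y)) ->
  exists g : 'rV['F_2]_d -> 'rV['F_2]_d,
    [/\ {morph g : x y / x + y}, injective g & P2 \o g =1 P1].
Proof.
move=> P10 P20 F1 F2 [f' fK f'K] fM.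
have uu (u : 'rV['F_2]_d) : u + u = 0 by apply/rowP=> i; rewrite !mxE F2_addrr.
have sq P theta (F : factor_for P theta) (x : 'F_2 * 'rV['F_2]_d) :
    twisted_mul theta x x = (P x.2, 0).
  by case: F => dg _ _; rewrite /twisted_mul dg F2_addrr add0r uu.
have f0 : f (0, 0) = (0, 0).
  have E := fM (0, 0) (0, 0); move: E; rewrite (twisted_mul1x P10 F1).
  have [k kK _] := twisted_left_bij theta2 (f (0, 0)).
  by rewrite -{1}[f (0, 0)](twisted_mulx1 P20 F2) => /(can_inj kK).
have [/forallP P1z|] := boolP [forall u, P1 u == 0].
  exists id; split=> // v /=; rewrite (eqP (P1z v)).
  have := sq _ _ F2 (0, v); rewrite -[(0, v)]f'K -fM (sq _ _ F1) (eqP (P1z _)) f0.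
  by rewrite f'K /= => -[<-].
rewrite negb_forall => /existsP[u0 P1u0].
have fz : f (1, 0) = (1, 0).
  have {P1u0}P1u0 : P1 u0 = 1 by case: (F2_cases (P1 u0)) P1u0 => ->; rewrite ?eqxx.
  have := fM (0, u0) (0, u0); rewrite (sq _ _ F1) (sq _ _ F2) P1u0 => E.
  case: (F2_cases (P2 (f (0, u0)).2)) => Q; rewrite E Q //.
  by move: E; rewrite Q -f0 => /(can_inj fK).
have fa a : f (a, 0) = (a, 0) by case: (F2_cases a) => ->.
pose g u := (f (0, u)).2.
have fE a u : f (a, u) = (a + (f (0, u)).1, g u).
  have -> : (a, u) = twisted_mul theta1 (a, 0) (0, u).
    by rewrite /twisted_mul /= (factor0l _ P10 F1) !addr0 add0r.
  by rewrite fM fa /twisted_mul /= (factor0l _ P20 F2) addr0 add0r.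
exists g; split=> [u v|u v|u].
- by have := congr1 snd (fM (0, u) (0, v)); rewrite {1}/twisted_mul fE.
- move=> Eg; suff : f (0, u) = f ((f (0, u)).1 + (f (0, v)).1, v).
    by move/(can_inj fK) => [].
  by rewrite (fE _ v) -Eg -addrA F2_addrr addr0 {1}fE add0r.
- by have := fM (0, u) (0, u); rewrite (sq _ _ F1) (sq _ _ F2) fa => -[].
Qed.

Lemma loop_isom_sym L M : loop_isom L M -> loop_isom M L.
Proof.
move=> [f [h fK hK] fM]; exists h; first by exists f.
by move=> x y; apply: (can_inj fK); rewrite fM !hK.
Qed.

Lemma loop_isom_trans L M N : loop_isom L M -> loop_isom M N -> loop_isom L N.
Proof.
move=> [f bf fM] [h bh hM]; exists (h \o f); first exact: bij_comp.
by move=> x y /=; rewrite fM hM.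
Qed.

Lemma loop_of_isomP w w' :
  loop_isom (loop_of w) (loop_of w') <->
  exists2 f : 'F_2 * 'rV['F_2]_d -> 'F_2 * 'rV['F_2]_d, bijective f &
    forall x y, f (twisted_mul (theta_of w) x y) =
                twisted_mul (theta_of w') (f x) (f y).
Proof.
pose T : finType := ('F_2 * 'rV['F_2]_d)%type.
have be : bijective (@encode T) := encode_bij T.
have bd : bijective (@decode T) := decode_bij T.
split=> [[f bf fM]|[f bf fM]].
- exists (fun x => decode (f (encode x))).
    exact: bij_comp bd (bij_comp bf be).
  by move=> x y; rewrite encode_mul fM /= /segment_mul encodeK.
- exists (fun x => encode (f (decode x))).
    exact: bij_comp be (bij_comp bf bd).
  by move=> x y; rewrite /= /segment_mul !encodeK fM.
Qed.

(** The isomorphism classes of the loops L_w are the classes of cubic functions under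
    linear substitution. *)
Lemma loop_of_isom_linear w w' :
  loop_isom (loop_of w) (loop_of w') <->
  exists2 T : 'M['F_2]_d, T \in unitmx & w = move T w'.
Proof.
rewrite loop_of_isomP; split=> [[f bf fM]|[T Tu wE]].
- have [g [gD gI gP]] := additive_of_twisted_iso (proj1 (cubic_peval w))
    (proj1 (cubic_peval w')) (factor_theta w) (factor_theta w') bf fM.
  have g0 : g 0 = 0 by apply: (addrI (g 0)); rewrite -gD !addr0.
  have gl : linear g.
    move=> a x y; rewrite gD; congr (_ + _).
    by case: (F2_cases a) => ->; rewrite ?scale0r ?scale1r.
  pose gL := GRing.isLinear.Build _ _ _ _ g gl.
  pose G : {linear 'rV['F_2]_d -> 'rV['F_2]_d} := HB.pack g gL.
  exists (lin1_mx G).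
    rewrite -row_free_unit -kermx_eq0; apply/rowV0P=> v /sub_kermxP.
    by move=> vG; apply: gI; rewrite g0 -[LHS](mul_rV_lin1 G) vG.
  by apply: peval_inj => x; rewrite peval_move mul_rV_lin1 /= -gP.
- apply: (@twisted_iso_of_additive (peval w) (peval w') _ _ (mulmxr T)).
  + exact: (proj1 (cubic_peval w)).
  + exact: factor_theta.
  + exact: factor_theta.
  + by move=> x y /=; exact: mulmxDl.
  + exists (mulmxr (invmx T)) => x /=; first by rewrite mulmxK.
    by rewrite mulmxKV.
  + by move=> x; rewrite wE peval_move.
Qed.


End LoopOf.

(** * The cubic function of a doubly even code *)

Lemma F2_natr (m : nat) : m%:R = (odd m)%:R :> 'F_2.
Proof. by rewrite -[in LHS](odd_double_half m) natrD -addnn natrD F2_addrr addr0. Qed.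

Lemma F2_natr_eq (m n : nat) : odd m = odd n -> m%:R = n%:R :> 'F_2.
Proof. by move=> E; rewrite F2_natr E -F2_natr. Qed.

Section Weight.
Variable n : nat.
Implicit Types u v t : 'rV['F_2]_n.

Lemma wtE u : wt u = (\sum_i (u 0%R i != 0%R : nat))%N.
Proof. by rewrite /wt cardsE -sum1_card big_mkcond. Qed.

Lemma wtD u v : (wt (u + v) + (wt (cap_vec u v)).*2 = wt u + wt v)%N.
Proof.
rewrite !wtE -muln2 big_distrl -!big_split /=; apply: eq_bigr => i _; rewrite !mxE.
by case: (F2_cases (u 0 i)) => ->; case: (F2_cases (v 0 i)) => ->.
Qed.

Lemma wt0 : wt (0 : 'rV['F_2]_n) = 0%N.
Proof. by rewrite wtE big1 // => i _; rewrite mxE eqxx. Qed.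

Lemma capDl u v t : cap_vec (u + v) t = cap_vec u t + cap_vec v t.
Proof. by apply/rowP=> i; rewrite !mxE mulrDl. Qed.

Lemma cap_cap u v t : cap_vec (cap_vec u t) (cap_vec v t) = cap_vec (cap_vec u v) t.
Proof.
apply/rowP=> i; rewrite !mxE.
by case: (F2_cases (t 0 i)) => ->; rewrite ?mulr0 ?mulr1.
Qed.

Variables (U : {vspace 'rV['F_2]_n}) (U4 : doubly_even U).
Implicit Types a b c : subvs_of U.

Definition code_form a : 'F_2 := (wt (vsval a) %/ 4)%:R.

Let vsvalD a b : vsval (a + b) = vsval a + vsval b := linearD (@vsval _ _ U) a b.

Lemma wt_code a : (wt (vsval a) = wt (vsval a) %/ 4 * 4)%N.
Proof. by rewrite divnK // U4 // subvsP. Qed.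

Lemma cap_even a b :
  wt (cap_vec (vsval a) (vsval b)) = (wt (cap_vec (vsval a) (vsval b)) %/ 2).*2.
Proof.
have := wtD (vsval a) (vsval b).
rewrite -vsvalD (wt_code a) (wt_code b) (wt_code (a + b)); lia.
Qed.

(** From |u + v| = |u| + |v| - 2 |u cap v|, divided by 4. *)
Lemma polar2_code a b :
  polar2 code_form a b = (wt (cap_vec (vsval a) (vsval b)) %/ 2)%:R.
Proof.
rewrite /polar2 /code_form -addrA -opprD -natrD.
apply/eqP; rewrite subr_eq -natrD; apply/eqP/F2_natr_eq.
have := wtD (vsval a) (vsval b).
rewrite -vsvalD (wt_code a) (wt_code b) (wt_code (a + b)).
have := cap_even a b; lia.
Qed.

(** The same identity for a cap c and b cap c, divided by 2. *)
Lemma polar3_code a b c :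
  polar3 code_form a b c =
    (wt (cap_vec (cap_vec (vsval a) (vsval b)) (vsval c)))%:R.
Proof.
rewrite /polar3 !polar2_code -addrA -opprD -natrD.
apply/eqP; rewrite subr_eq -natrD; apply/eqP/F2_natr_eq.
have := wtD (cap_vec (vsval a) (vsval c)) (cap_vec (vsval b) (vsval c)).
rewrite -capDl cap_cap -vsvalD.
have := cap_even (a + b) c; have := cap_even a c; have := cap_even b c.
lia.
Qed.

Lemma cubic_code : cubic code_form.
Proof.
split=> [|a b c t]; first by rewrite /code_form linear0 wt0.
rewrite !polar3_code linearD !capDl -natrD; apply: F2_natr_eq.
set u := cap_vec (cap_vec (vsval a) _) _; set v := cap_vec _ _.
have := wtD u v; lia.
Qed.

Lemma factor_setP theta : factor_set theta <-> factor_for code_form theta.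
Proof.
split=> -[dg com coc]; split=> // *.
- by rewrite com polar2_code.
- by rewrite coc polar3_code.
- by rewrite com polar2_code.
- by rewrite coc polar3_code.
Qed.

End Weight.

Lemma loop_order_card (L : loop) (T : finType) (f : T -> L) m :
  bijective f -> loop_order L m <-> #|T| = m.
Proof.
move=> bf.
have E : ([set: L] #= `I_#|T|)%card.
  have [h fK hK] := bf.
  apply/pcard_eqP/bijPex; exists (fun x => nat_of_ord (enum_rank (h x))); split.
  - by move=> x _ /=; exact: ltn_ord.
  - by move=> x y _ _ /val_inj/enum_rank_inj/(can_inj hK).
  - move=> k kT; exists (f (enum_val (Ordinal kT))) => //=.
    by rewrite fK enum_valK.
rewrite /loop_order; split=> [Lm|<-//].
by apply/card_eq_II; apply: card_eq_trans Lm; exact: card_esym.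
Qed.

Section Coordinates.
Import VectorInternalTheory.

(** Comparing orders, the code has dimension d; in coordinates its cubic function is
    some P_w, and two loops with the same cubic function are isomorphic. *)
Lemma code_loop_form d (L : loop) : code_loop L -> loop_order L (2 ^ d.+1) ->
  exists w : Omega d, loop_isom (loop_of w) L.
Proof.
move=> [n [U [theta [U4 /(factor_setP U4) F [f bf fM]]]]] Lo.
pose X : vectType 'F_2 := subvs_of U.
have [h [hD bh]] : exists h : 'rV['F_2]_(dim X) -> X,
    {morph h : x y / x + y} /\ bijective h.
  by exists r2v; split; [exact: linearD|exists v2r; [exact: r2vK|exact: v2rK]].
have bF k (h' : 'rV['F_2]_k -> X) : bijective h' ->
    bijective (fun x : 'F_2 * 'rV['F_2]_k => f (x.1, h' x.2)).
  move=> [h1 h'K h1K]; apply: bij_comp bf _.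
  by exists (fun y => (y.1, h1 y.2)) => -[a y] /=; rewrite ?h'K ?h1K.
have : #|{: 'F_2 * 'rV['F_2]_(dim X)}| = (2 ^ d.+1)%N.
  exact/(loop_order_card _ (bF _ h bh)).
rewrite card_prod card_mx card_Fp // mul1n -expnS => /(@expnI 2 isT) [dX].
move: h hD bh; rewrite dX => h hD bh.
pose P := code_form (U := U) \o h.
have cP : cubic P := cubic_comp hD (cubic_code U4).
pose w := coef P 1%:M.
have [g bg gM] : exists2 g : 'F_2 * 'rV['F_2]_d -> 'F_2 * 'rV['F_2]_d, bijective g &
    forall x y, g (twisted_mul (theta_of w) x y) =
                twisted_mul (fun x y => theta (h x) (h y)) (g x) (g y).
  apply: (twisted_iso_of_additive (g := id) _ (factor_theta w)
    (factor_comp hD F)) => //.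
  - exact: (proj1 (cubic_peval w)).
  - by exists id.
  - by move=> x /=; rewrite peval_coef.
exists w, (fun x => f ((g (decode x)).1, h (g (decode x)).2)).
  exact: bij_comp (bF _ h bh) (bij_comp bg (decode_bij _)).
move=> x y; rewrite -fM /= /segment_mul encodeK gM.
by congr f; rewrite /twisted_mul /code_mul /= hD.
Qed.

End Coordinates.

(** * Doubly even codes with a given cubic function *)

Section Realization.
Variable d : nat.
Implicit Types (x b c : 'rV['F_2]_d) (s : seq 'rV['F_2]_d).

Definition dot x b : 'F_2 := (x *m b^T) 0 0.

Lemma dotD x b c : dot x (b + c) = dot x b + dot x c.
Proof. by rewrite /dot linearD mulmxDr mxE. Qed.

Lemma dot_delta x i : dot x (delta_mx 0 i) = x 0 i.
Proof. by rewrite /dot trmx_delta -colE mxE. Qed.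

(** A list s of columns sends x to the word with entries dot x b, for b in s; the
    condition says that this word has weight divisible by 4 and weight over 4 equal to
    P x modulo 2. *)
Definition realizable (P : 'rV['F_2]_d -> 'F_2) :=
  exists s, forall x,
    count (fun b => dot x b != 0) s = (4 * (P x != 0%R))%N %[mod 8].

Lemma eq_realizable P Q : P =1 Q -> realizable P -> realizable Q.
Proof. by move=> PQ [s sP]; exists s => x; rewrite -PQ. Qed.

Lemma realizable0 : realizable (fun=> 0).
Proof. by exists [::] => x; rewrite eqxx. Qed.

Lemma realizableD P Q : realizable P -> realizable Q -> realizable (fun x => P x + Q x).
Proof.
move=> [s sP] [t tQ]; exists (s ++ t) => x.
rewrite count_cat -modnDm sP tQ modnDm.
by case: (F2_cases (P x)) => ->; case: (F2_cases (Q x)) => ->.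
Qed.

Lemma realizable_scale (a : 'F_2) P : realizable P -> realizable (fun x => P x * a).
Proof.
move=> rP; case: (F2_cases a) => ->.
  by apply: eq_realizable realizable0 => x; rewrite mulr0.
by apply: eq_realizable rP => x; rewrite mulr1.
Qed.

Lemma realizable_sum (I : Type) (r : seq I) (F : I -> 'rV['F_2]_d -> 'F_2) :
  (forall i, realizable (F i)) -> realizable (fun x => \sum_(i <- r) F i x).
Proof.
move=> rF; elim: r => [|i r IH].
  by apply: eq_realizable realizable0 => x; rewrite big_nil.
by apply: eq_realizable (realizableD (rF i) IH) => x; rewrite big_cons.
Qed.

(** For bits p, q, r, with (+) the sum modulo 2,
      4pqr = p + q + r + (p (+) q (+) r) - (p (+) q) - (p (+) r) - (q (+) r)
    over the integers; modulo 8 the coefficient -1 is 7. *)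
Lemma realizable_dot3 b c e : realizable (fun x => dot x b * dot x c * dot x e).
Proof.
exists ([:: b; c; e; b + c + e] ++
  nseq 7 (b + c) ++ nseq 7 (b + e) ++ nseq 7 (c + e)) => x.
rewrite !count_cat !count_nseq /= !dotD.
by case: (F2_cases (dot x b)) => ->; case: (F2_cases (dot x c)) => ->;
   case: (F2_cases (dot x e)) => ->.
Qed.

(** Since a * a = a, monomials of degree 1 and 2 are products of three coordinates
    with repetitions. *)
Lemma realizable_peval (w : Omega d) : realizable (peval w).
Proof.
have sq (a : 'F_2) : a * a = a by case: (F2_cases a) => ->; rewrite ?mul0r ?mul1r.
have rX i j k : realizable (fun x => x 0 i * x 0 j * x 0 k).
  apply: eq_realizable (realizable_dot3 (delta_mx 0 i) (delta_mx 0 j) (delta_mx 0 k)).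
  by move=> x; rewrite !dot_delta.
apply: realizableD; first apply: realizableD; apply: realizable_sum.
- move=> i; apply: realizable_scale; apply: eq_realizable (rX i i i) => x.
  by rewrite !sq.
- move=> [[i j] /= h]; apply: realizable_scale; apply: eq_realizable (rX i i j) => x.
  by rewrite sq.
- by move=> [[[i j] k] /= h]; apply: realizable_scale; exact: rX.
Qed.

Lemma code_of_form (w : Omega d) : exists n (B : 'M['F_2]_(d, n)),
  row_free B /\ forall x, wt (x *m B) = (4 * (peval w x != 0%R))%N %[mod 8].
Proof.
have [s sP] := realizable_peval w.
(* Eight copies of each basis vector make x *m B determine x, and leave the weights
   unchanged modulo 8. *)
pose r := s ++ flatten [seq nseq 8 (delta_mx 0%R i : 'rV['F_2]_d) | i <- enum 'I_d].
pose B : 'M['F_2]_(d, size r) := \matrix_(i, j) (nth 0 r j) 0 i.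
have BE x j : (x *m B) 0 j = dot x (nth 0 r j).
  by rewrite /dot !mxE; apply: eq_bigr => i _; rewrite !mxE.
exists (size r), B; split.
  rewrite -kermx_eq0; apply/rowV0P=> x /sub_kermxP xB.
  apply/rowP=> i; rewrite mxE -dot_delta.
  have ir : delta_mx 0 i \in r.
    rewrite mem_cat; apply/orP; right; apply/flatten_mapP; exists i.
      by rewrite mem_enum.
    by rewrite mem_nseq eqxx.
  move: (ir); rewrite -index_mem => lt_ir.
  by have := BE x (Ordinal lt_ir); rewrite xB mxE /= nth_index // => <-.
move=> x.
have -> : wt (x *m B) = count (fun b => dot x b != 0) r.
  rewrite wtE -sum1_count (big_nth 0) big_mkord [RHS]big_mkcond.
  by apply: eq_bigr => j _; rewrite BE; case: (_ != _).
rewrite count_cat -modnDmr count_flatten -map_comp.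
have dvd8 i : (8 %| count (fun b => dot x b != 0%R) (nseq 8 (delta_mx 0%R i)))%N.
  by rewrite count_nseq dvdn_mull.
set m := sumn _; suff /eqP -> : (8 %| m)%N by rewrite addn0.
rewrite /m sumnE big_map; apply: (big_ind (dvdn 8)) => // [a b|i _].
  exact: dvdn_add.
exact: dvd8.
Qed.

(** The factor set of P_w is carried to the row space of B, where the weight over 4 is
    P_w by the choice of B. *)
Lemma code_loop_of (w : Omega d) : code_loop (loop_of w).
Proof.
have [n [B [Bf wtB]]] := code_of_form w.
pose U := limg (linfun (mulmxr B) : 'Hom('rV['F_2]_d, 'rV['F_2]_n)).
pose h' (u : subvs_of U) := vsval u *m pinvmx B.
have UP u : u \in U -> exists x, u = x *m B.
  by case/memv_imgP=> x _ ->; exists x; rewrite lfunE.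
have h'K u : h' u *m B = vsval u.
  by rewrite /h'; have [x ->] := UP _ (subvsP u); rewrite mulmxKp.
have wtU x : (wt (x *m B) %/ 4)%:R = peval w x.
  have := wtB x; case: (F2_cases (peval w x)) => -> /= E; rewrite F2_natr.
    by rewrite (_ : odd _ = false) //; lia.
  by rewrite (_ : odd _ = true) //; lia.
have U4 : doubly_even U.
  move=> u /UP[x ->]; have := wtB x; case: (_ != 0); lia.
have h'D : {morph h' : u v / u + v}.
  by move=> u v; rewrite /h' linearD mulmxDl.
exists n, U, (fun u v => theta_of w (h' u) (h' v)); split=> //.
  apply/(factor_setP U4); have := factor_comp h'D (factor_theta w).
  by apply: eq_factor_for => u /=; rewrite -wtU h'K.
exists (fun p => encode (p.1, h' p.2)).
  apply: bij_comp (encode_bij _) _.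
  exists (fun p => (p.1, vsproj U (p.2 *m B))) => -[a u] /=; congr (_, _).
    by rewrite h'K vsvalK.
  rewrite /h' vsprojK ?mulmxKp //.
  by apply/memv_imgP; exists u; rewrite ?memvf ?lfunE.
move=> x y; rewrite /= -encode_mul; congr encode.
by rewrite /code_mul /twisted_mul /= h'D.
Qed.

Lemma loop_order_loop_of (w : Omega d) : loop_order (loop_of w) (2 ^ d.+1).
Proof.
pose T : finType := ('F_2 * 'rV['F_2]_d)%type.
apply/(loop_order_card (L := loop_of w) (f := @encode T)).
  exact: encode_bij.
by rewrite card_prod card_mx card_Fp // mul1n -expnS.
Qed.

End Realization.

(** * Orbit representatives along an equivariant map *)

Section TwoStage.
Variables (gT : finGroupType) (T1 T2 : finType).
Variables (to1 : {action gT &-> T1}) (to2 : {action gT &-> T2}) (p : T1 -> T2).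
Hypothesis p_equiv : forall x a, p (to1 x a) = to2 (p x) a.

Lemma orbit_repsP (T : finType) (to : {action gT &-> T}) (A : {group gT})
    (Y X : {set T}) :
  [acts A, on Y | to] ->
  reflect (X \subset Y /\ forall y, y \in Y -> exists x, X :&: orbit to A y = [set x])
    (orbit_reps to A Y X).
Proof.
move=> actAY; rewrite /orbit_reps /is_transversal /orbits orbit_partition //=.
apply: (iffP andP) => -[XY H]; split=> //.
- move=> y Yy; apply/cards1P; move/forall_inP: H; apply; exact: imset_f.
- by apply/forall_inP=> _ /imsetP[y Yy ->]; apply/cards1P; exact: H.
Qed.

Lemma acts_fibre y : [acts 'C[y | to2], on [set x | p x == y] | to1].
Proof.
apply/actsP=> a /astab1P ya x; rewrite !inE p_equiv -{1}ya.
by rewrite (inj_eq (act_inj to2 a)).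
Qed.

(** Every x can be moved so that p x is the representative y of its orbit, and the
    elements of the orbit of x that lie over y form one orbit of the stabilizer
    of y. *)
Lemma orbit_reps_two_stage (R2 : {set T2}) (R1 : T2 -> {set T1}) :
  orbit_reps to2 setT setT R2 ->
  (forall y, y \in R2 -> orbit_reps to1 'C[y | to2] [set x | p x == y] (R1 y)) ->
  orbit_reps to1 setT setT [set x | (p x \in R2) && (x \in R1 (p x))].
Proof.
have actT (T : finType) (to : {action gT &-> T}) : [acts [set: gT], on setT | to].
  by apply/actsP=> a _ x; rewrite !inE.
move=> /(orbit_repsP _ (actT _ to2))[_ H2] H1.
apply/(orbit_repsP _ (actT _ to1)); split; first exact: subsetT.
move=> x _; have [y yP] := H2 (p x) (in_setT _).
have /setIP[R2y /orbitP[a _ pxa]] : y \in R2 :&: orbit to2 setT (p x).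
  by rewrite yP set11.
have /(orbit_repsP _ (acts_fibre y))[R1y {}H1] := H1 y R2y.
have [z zP] : exists z, R1 y :&: orbit to1 'C[y | to2] (to1 x a) = [set z].
  by apply: H1; rewrite inE p_equiv pxa.
exists z; apply/setP=> t; rewrite in_setI in_set1 in_set; apply/andP/eqP => [[]|->].
- move=> /andP[R2t R1t] xt; have pt : p t = y.
    apply/set1P; rewrite -yP inE R2t.
    by have /orbitP[b _ <-] := xt; rewrite p_equiv mem_orbit ?inE.
  apply/set1P; rewrite -zP inE -{1}pt R1t; have /orbitP[b _ tE] := xt.
  apply/orbitP; exists (a^-1 * b)%g; last by rewrite -actM mulKVg.
  by apply/astab1P; rewrite -{1}pxa -actM mulKVg -p_equiv tE.
- have /setIP[R1z /orbitP[c _ zE]] : z \in R1 y :&: orbit to1 'C[y | to2] (to1 x a).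
    by rewrite zP set11.
  have := subsetP R1y z R1z; rewrite inE => /eqP pz.
  rewrite pz R2y R1z; split=> //.
  by rewrite -zE -actM mem_orbit ?inE.
Qed.

End TwoStage.

(** * The action of the linear group *)

Section InvCoords.
Import passmx.
Variables (V : vectType 'F_2).
Variables (e : (\dim {:V}).-tuple V) (e_basis : basis_of fullv e).

Lemma inv_coords_mxof (S : GL V) : inv_coords e S = mxof e e (S^-1)%g.
Proof. by apply/matrixP=> u i; rewrite !mxE /= vecof_delta (tnth_nth 0). Qed.

Lemma inv_coords1 : inv_coords e 1%g = 1%:M.
Proof. by rewrite inv_coords_mxof invg1 mxof1 ?(basis_free e_basis). Qed.

(** Since e_u (ST)^-1 = (e_u T^-1) S^-1, the matrices multiply in the opposite order.
    This suits [move_mul], where the left factor acts last. *)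
Lemma inv_coordsM S T : inv_coords e (S * T)%g = inv_coords e T *m inv_coords e S.
Proof. by rewrite !inv_coords_mxof invMg (mxof_comp _ _ e_basis). Qed.

Lemma inv_coords_unit S : inv_coords e S \in unitmx.
Proof.
have := inv_coordsM S S^-1; rewrite mulgV inv_coords1 => /esym.
by case/mulmx1_unit.
Qed.

Lemma inv_coords_surj A : A \in unitmx -> exists S, inv_coords e S = A.
Proof.
move=> Au; have K : lker (hommx e e A) == 0%VS.
  apply/lker0P=> u v; rewrite !hommxE //.
  move/(can_inj (vecofK e_basis))/(can_inj (mulmxK Au)).
  exact: (can_inj (rVofK e_basis)).
by exists (MkGL K)^-1%g; rewrite inv_coords_mxof invgK /= hommxK.
Qed.

End InvCoords.

Theorem corollary3p8 (d : nat) (d_ge3 : (3 <= d)%N)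
    (V : vectType 'F_2) (e : d.-tuple V) (e_basis : basis_of fullv e) :
  exists (to : {action GL V &-> Omega d})
         (to23 : {action GL V &-> Omega23 d})
         (to3 : {action GL V &-> Omega3 d}),
    [/\ [/\ forall x S, to x S = move (inv_coords e S) x,
            forall x S, to23 x S = move23 (inv_coords e S) x
          & forall x S, to3 x S = move3 (inv_coords e S) x],
        exists Phi : {set Omega d} -> set loop,
          set_bij [set` orbits to setT setT]%classic (code_loop_classes (2 ^ d.+1)) Phi
      & forall (R3 : {set Omega3 d})
               (R2 : Omega3 d -> {set Omega23 d})
               (R1 : Omega23 d -> {set Omega d}),
          orbit_reps to3 setT setT R3 ->
          (forall w3, w3 \in R3 ->
             orbit_reps to23 'C[w3 | to3] [set x | x.2 == w3] (R2 w3)) ->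
          (forall w3 w23, w3 \in R3 -> w23 \in R2 w3 ->
             orbit_reps to 'C[w23 | to23] [set x | x.2 == w23] (R1 w23)) ->
          orbit_reps to setT setT
            [set x : Omega d | [&& x.2.2 \in R3, x.2 \in R2 x.2.2
                                 & x \in R1 x.2]]].
Proof.
have dE := size_basis e_basis; subst d.
pose actF x (S : GL V) := move (inv_coords e S) x.
pose act23 x (S : GL V) := move23 (inv_coords e S) x.
pose act3 x (S : GL V) := move3 (inv_coords e S) x.
have actF1 x : actF x 1%g = x by rewrite /actF inv_coords1 // move_one.
have actFM x S T : actF x (S * T)%g = actF (actF x S) T.
  by rewrite /actF inv_coordsM // move_mul.
(* The action laws on the upper layers are those of the whole space, read on vectors
   whose lower layers are zero. *)
pose lift23 y : Omega (\dim {:V}) := ([ffun=> 0], y).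
pose lift3 z : Omega23 (\dim {:V}) := ([ffun=> 0], z).
have act231 y : act23 y 1%g = y := congr1 snd (actF1 (lift23 y)).
have act23M y S T : act23 y (S * T)%g = act23 (act23 y S) T :=
  congr1 snd (actFM (lift23 y) S T).
have act31 z : act3 z 1%g = z := congr1 snd (act231 (lift3 z)).
have act3M z S T : act3 z (S * T)%g = act3 (act3 z S) T :=
  congr1 snd (act23M (lift3 z) S T).
pose to : {action GL V &-> Omega (\dim {:V})} := TotalAction actF1 actFM.
pose to23 : {action GL V &-> Omega23 (\dim {:V})} := TotalAction act231 act23M.
pose to3 : {action GL V &-> Omega3 (\dim {:V})} := TotalAction act31 act3M.
have isomP w w' : loop_isom (loop_of w) (loop_of w') <-> w' \in orbit to setT w.
  rewrite loop_of_isom_linear orbit_sym; split.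
    move=> [T /(inv_coords_surj e_basis)[S <-] ->].
    by apply/orbitP; exists S; rewrite ?inE.
  by move=> /orbitP[S _ <-]; exists (inv_coords e S); first exact: inv_coords_unit.
exists to, to23, to3; split=> //.
  exists (fun O : {set Omega (\dim {:V})} =>
    [set L | exists2 w, w \in O & loop_isom (loop_of w) L]%classic).
  have PhiE w :
      [set L | exists2 w', w' \in orbit to setT w & loop_isom (loop_of w') L]%classic
      = [set L | loop_isom (loop_of w) L]%classic.
    apply/seteqP; split=> [L [w' ww' w'L]|L wL].
      by apply: loop_isom_trans w'L; apply/isomP.
    by exists w => //; exact: orbit_refl.
  split.
  - move=> _ /imsetP[w _ ->]; rewrite PhiE; exists (loop_of w) => //.
    by split; [exact: code_loop_of|exact: loop_order_loop_of].
  - move=> _ _ /set_mem/imsetP[w _ ->] /set_mem/imsetP[w' _ ->]; rewrite !PhiE => E.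
    apply/esym/orbit_eqP/isomP.
    have : [set L | loop_isom (loop_of w') L]%classic (loop_of w').
      by exists id => //; exists id.
    by rewrite -E.
  - move=> _ [L [cL oL] <-]; have [w wL] := code_loop_form cL oL.
    exists (orbit to setT w); first exact: imset_f.
    rewrite PhiE; apply/seteqP; split=> M /=; last exact: loop_isom_trans.
    by apply: loop_isom_trans; exact: loop_isom_sym.
move=> R3 R2 R1 H3 H2 H1.
have H23 := orbit_reps_two_stage (to1 := to23) (fun _ _ => erefl) H3 H2.
have := orbit_reps_two_stage (to1 := to) (to2 := to23) (p := snd) (R1 := R1)
  (fun _ _ => erefl) H23.
have -> : [set x : Omega (\dim {:V}) | [&& x.2.2 \in R3, x.2 \in R2 x.2.2
                                        & x \in R1 x.2]] =
  [set x | (x.2 \in [set y : Omega23 (\dim {:V}) | (y.2 \in R3) && (y \in R2 y.2)])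
           && (x \in R1 x.2)].
  by apply/setP=> x; rewrite !inE andbA.
by apply=> y; rewrite inE => /andP[]; exact: H1.
Qed.
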